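(* Let $(\Lambda,d)$ be a row-finite $k$-graph with no sources, and let $p\in\mathbb{N}^k$. Let $\{s_\lambda:\lambda\in\Lambda\}$ be the universal generating Cuntz-Krieger $\Lambda$-family in $C^*(\Lambda)$ and $\{t_\lambda:\lambda\in p\Lambda\}$ the universal generating Cuntz-Krieger $p\Lambda$-family in $C^*(p\Lambda)$. For $\lambda\in p\Lambda$ put $r_\lambda:=s_\lambda s_{s_p(\lambda)}^*$. Then there is an isomorphism $\phi:C^*(p\Lambda)\to C^*(\Lambda)$ such that $\phi(t_\lambda)=r_\lambda$ for all $\lambda\in p\Lambda$.
   Context: A $k$-graph is a pair $(\Lambda,d)$ where $\Lambda$ is a countable category and $d:\Lambda\to\mathbb{N}^k$ is a functor satisfying the factorisation property: if $d(\lambda)=m+n$ then there are unique $\mu\in d^{-1}(m)$, $\nu\in d^{-1}(n)$ with $\lambda=\mu\nu$. Vertices are identified with paths of degree $0$; $r,s$ are codomain and domain; $\Lambda^n:=d^{-1}(n)$, and for a vertex $v$, $v\Lambda^n:=\{\lambda\in\Lambda^n:r(\lambda)=v\}$. $\Lambda$ is row-finite if $v\Lambda^n$ is finite for all vertices $v$ and $n\in\mathbb{N}^k$, and has no sources if $v\Lambda^n\neq\emptyset$ for all $v,n$. For $d(\lambda)=n$ and $l\le m\le n$, $\lambda(l,m)$ is the unique path of degree $m-l$ with $\lambda=\lambda(0,l)\lambda(l,m)\lambda(m,n)$. The dual $k$-graph $p\Lambda$ has paths $\{\lambda:d(\lambda)\ge p\}$, vertices $\Lambda^p$, range $r_p(\lambda)=\lambda(0,p)$,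 source $s_p(\lambda)=\lambda(d(\lambda)-p,d(\lambda))$, composition $\lambda\circ_p\mu=\lambda\,\mu(p,d(\mu))$ when $s_p(\lambda)=r_p(\mu)$, degree $d_p(\lambda)=d(\lambda)-p$; it is row-finite with no sources when $\Lambda$ is. For a row-finite $k$-graph $\Gamma$ with no sources, a Cuntz-Krieger $\Gamma$-family is a collection $\{t_\lambda:\lambda\in\Gamma\}$ of partial isometries such that (i) $\{t_v:v\in\Gamma^0\}$ are mutually orthogonal projections; (ii) $t_\lambda t_\mu=t_{\lambda\mu}$ when $s(\lambda)=r(\mu)$; (iii) $t_\lambda^*t_\lambda=t_{s(\lambda)}$; (iv) $t_v=\sum_{\lambda\in v\Gamma^n}t_\lambda t_\lambda^*$ for all $v\in\Gamma^0$, $n\in\mathbb{N}^k$. $C^*(\Gamma)$ is the $C^*$-algebra generated by a Cuntz-Krieger $\Gamma$-family that is universal for such families. *)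

(* Defs.v *)
(* mathcomp + mathcomp-classical + mathcomp-reals + real_closed complex *)
From HB Require Import structures.
From mathcomp Require Import all_boot all_order all_algebra.
From mathcomp Require Import boolp classical_sets cardinality fsbigop reals.
From mathcomp Require Import complex.
From Stdlib Require Import ClassicalEpsilon.
Set Implicit Arguments. Unset Strict Implicit. Unset Printing Implicit Defensive.
Import Order.TTheory GRing.Theory Num.Theory.
Local Open Scope ring_scope.
Local Open Scope classical_set_scope.

(* Degrees: N^k as finite functions 'I_k -> nat (pointwise operations) *)
Definition nvec (k : nat) := {ffun 'I_k -> nat}.
Definition vzero k : nvec k := [ffun _ => 0%N].
Definition vadd k (m n : nvec k) : nvec k := [ffun i => (m i + n i)%N].
Definition vsub k (m n : nvec k) : nvec k := [ffun i => (m i - n i)%N].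
Definition vle k (m n : nvec k) : bool := [forall i, (m i <= n i)%N].

(* k-graph data: a (countable) set of paths (morphisms) with degree,   *)
(* range, source and composition.  Vertices = paths of degree 0        *)
(* (identified with the identity morphisms).  Composition is total as  *)
(* a function but only meaningful when s(lam) = r(mu).                 *)
Record kgdata (k : nat) := KGData {
  kpath : countType;
  kdeg : kpath -> nvec k;
  kr : kpath -> kpath;
  ks : kpath -> kpath;
  kcomp : kpath -> kpath -> kpath }.

Section KGraph.
Variables (k : nat) (G : kgdata k).
Local Notation P := (kpath G).
Local Notation d := (@kdeg k G).
Local Notation r := (@kr k G).
Local Notation s := (@ks k G).
Local Notation comp := (@kcomp k G).

Definition is_vertex (v : P) : Prop := d v = vzero k.

(* (Lambda, d) is a k-graph: a category whose objects are the degree-0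
   paths (the identities), d is a functor to N^k, and the factorisation
   property holds. *)
Definition is_kgraph : Prop :=
  [/\ (forall lam, is_vertex (r lam) /\ is_vertex (s lam))
      /\ (forall v, is_vertex v -> r v = v /\ s v = v),
      (forall lam mu, s lam = r mu ->
          r (comp lam mu) = r lam /\ s (comp lam mu) = s mu
          /\ d (comp lam mu) = vadd (d lam) (d mu)),
      (forall lam mu nu, s lam = r mu -> s mu = r nu ->
          comp (comp lam mu) nu = comp lam (comp mu nu)),
      (forall lam, comp (r lam) lam = lam /\ comp lam (s lam) = lam) &
      (forall lam (m n : nvec k), d lam = vadd m n ->
          exists mu nu, [/\ d mu = m, d nu = n, s mu = r nu, lam = comp mu nu &
            forall mu' nu', d mu' = m -> d nu' = n -> s mu' = r nu' ->
              lam = comp mu' nu' -> mu' = mu /\ nu' = nu])].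

(* v Lambda^n *)
Definition rdeg_set (v : P) (n : nvec k) : set P :=
  [set lam | r lam = v /\ d lam = n].

Definition row_finite : Prop :=
  forall v n, is_vertex v -> finite_set (rdeg_set v n).

Definition no_sources : Prop :=
  forall v n, is_vertex v -> rdeg_set v n !=set0.

(* lam(l, m): the unique path of degree m - l with
   lam = lam(0,l) lam(l,m) lam(m, d(lam)) (chosen by Hilbert epsilon;
   it is the correct segment whenever G is a k-graph and l <= m <= d lam) *)
Definition seg (lam : P) (l m : nvec k) : P :=
  epsilon (inhabits lam) (fun nu => exists mu rho,
    [/\ d mu = l /\ d nu = vsub m l, d rho = vsub (d lam) m,
        s mu = r nu, s nu = r rho & lam = comp (comp mu nu) rho]).

(* ---------------- the dual k-graph p Lambda ---------------- *)
Variable p : nvec k.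
Definition dpath : countType := {lam : P | vle p (d lam)}.
Definition dval (x : dpath) : P := sval x.
Definition ddeg (x : dpath) : nvec k := vsub (d (dval x)) p.
(* r_p(lam) = lam(0,p) ; s_p(lam) = lam(d lam - p, d lam)  (as Lambda-paths) *)
Definition dr_path (x : dpath) : P := seg (dval x) (vzero k) p.
Definition ds_path (x : dpath) : P := seg (dval x) (vsub (d (dval x)) p) (d (dval x)).
(* lam o_p mu = lam mu(p, d mu) *)
Definition dcomp_path (x y : dpath) : P :=
  comp (dval x) (seg (dval y) p (d (dval y))).
(* lift back into p Lambda (the default is never used when G is a k-graph) *)
Definition dr (x : dpath) : dpath := insubd x (dr_path x).
Definition ds (x : dpath) : dpath := insubd x (ds_path x).
Definition dcomp (x y : dpath) : dpath := insubd x (dcomp_path x y).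
End KGraph.

Definition dual k (G : kgdata k) (p : nvec k) : kgdata k :=
  @KGData k (dpath G p) (@ddeg k G p) (@dr k G p) (@ds k G p) (@dcomp k G p).

(* C*-algebras (possibly non-unital) over C = R[i], R : realType       *)
Section CStarAxioms.
Variables (R : realType) (A : lmodType R[i]).
Variables (mul : A -> A -> A) (star : A -> A) (nrm : A -> R).

Definition cstar_axioms : Prop :=
  (* associative bilinear multiplication *)
      (forall a b c, mul (mul a b) c = mul a (mul b c)) /\
      (forall (z : R[i]) a b c, mul (z *: a + b) c = z *: mul a c + mul b c) /\
      (forall (z : R[i]) a b c, mul a (z *: b + c) = z *: mul a b + mul a c) /\
      (* involution *)
      (forall a, star (star a) = a) /\
      (forall (z : R[i]) a b, star (z *: a + b) = (z^*)%C *: star a + star b) /\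
      (forall a b, star (mul a b) = mul (star b) (star a)) /\
      (* norm *)
      (forall a, nrm a = 0 <-> a = 0) /\
      (forall a b, nrm (a + b) <= nrm a + nrm b) /\
      (forall (z : R[i]) a, ((nrm (z *: a))%:C)%C = `|z| * ((nrm a)%:C)%C) /\
      (forall a b, nrm (mul a b) <= nrm a * nrm b) /\
      (* C*-identity *)
      (forall a, nrm (mul (star a) a) = nrm a ^+ 2) /\
      (* completeness *)
      (forall u : nat -> A,
         (forall e : R, 0 < e -> exists N, forall m n, (N <= m)%N -> (N <= n)%N ->
              nrm (u m - u n) < e) ->
         exists a, forall e : R, 0 < e -> exists N, forall n, (N <= n)%N ->
              nrm (u n - a) < e).
End CStarAxioms.

Record cstar (R : realType) := CStar {
  cs_car :> lmodType R[i];
  cs_mul : cs_car -> cs_car -> cs_car;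
  cs_star : cs_car -> cs_car;
  cs_norm : cs_car -> R;
  cs_ax : cstar_axioms cs_mul cs_star cs_norm }.

Section CStarNotions.
Variable R : realType.

(* *-homomorphisms and *-isomorphisms *)
Definition star_hom (A B : cstar R) (f : A -> B) : Prop :=
  [/\ (forall (z : R[i]) a b, f (z *: a + b) = z *: f a + f b),
      (forall a b, f (cs_mul a b) = cs_mul (f a) (f b)) &
      (forall a, f (cs_star a) = cs_star (f a))].

Definition star_iso (A B : cstar R) (f : A -> B) : Prop :=
  star_hom f /\ bijective f.

(* S generates A as a C*-algebra: the only norm-closed *-subalgebra of A
   containing S is A itself *)
Definition generates (A : cstar R) (S : set A) : Prop :=
  forall X : set A,
    S `<=` X ->
    (forall a b, X a -> X b -> X (a + b)) ->
    (forall (z : R[i]) a, X a -> X (z *: a)) ->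
    (forall a b, X a -> X b -> X (cs_mul a b)) ->
    (forall a, X a -> X (cs_star a)) ->
    (forall (u : nat -> A) a, (forall n, X (u n)) ->
       (forall e : R, 0 < e -> exists N, forall n, (N <= n)%N -> cs_norm (u n - a) < e) ->
       X a) ->
    X = setT.

(* Cuntz-Krieger G-family in A *)
Definition CK_family k (G : kgdata k) (A : cstar R) (t : kpath G -> A) : Prop :=
  [/\ (forall v, is_vertex v -> cs_mul (t v) (t v) = t v /\ cs_star (t v) = t v),
      (forall v w, is_vertex v -> is_vertex w -> v <> w -> cs_mul (t v) (t w) = 0),
      (forall lam mu, ks lam = kr mu -> cs_mul (t lam) (t mu) = t (kcomp lam mu)),
      (forall lam, cs_mul (cs_star (t lam)) (t lam) = t (ks lam)) &
      (forall v n, is_vertex v ->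
         t v = \sum_(lam \in rdeg_set v n) cs_mul (t lam) (cs_star (t lam)))].

(* (A, t) is a universal C*-algebra C*(G) with its universal generating
   Cuntz-Krieger G-family t *)
Definition universal_CK k (G : kgdata k) (A : cstar R) (t : kpath G -> A) : Prop :=
  [/\ CK_family t,
      generates (range t) &
      forall (B : cstar R) (q : kpath G -> B), CK_family q ->
        exists pi : A -> B, star_hom pi /\ forall lam, pi (t lam) = q lam].
End CStarNotions.

(* Main.v *)
(** The family r_x = s_x s_(s_p x)^* satisfies the Cuntz-Krieger relations of p Lambda, and
    conversely q_a = \sum_(v in s(a) Lambda^p) t_(a v) satisfies those of Lambda.
    The *-homomorphisms given by the two universal properties are mutually inverse on
    generators, hence everywhere, because a *-homomorphism is automatically bounded; this
    avoids the gauge-invariant uniqueness theorem.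

    Boundedness: for h selfadjoint and small, 1 - h^2 = (1 - b)^2 with b selfadjoint and
    commuting with h, so f(h) + i(1 - f(b)) is unitary (in the unitization) and
    |f(h)| <= 1.

    The relations force paths of equal degree to have orthogonal ranges, since projections
    whose sum is a projection are orthogonal; the order theory of C*-algebras is replaced
    here by the fact that a projection e is an extreme point of the unit ball of its corner,
    which follows from 2(c e + (n+1)h) = (e+h)((c+1)e + n h) + (e-h)((c-1)e + n h). *)
Require Import Defs.
From HB Require Import structures.
From mathcomp Require Import all_boot all_order all_algebra.
From mathcomp Require Import boolp classical_sets cardinality fsbigop reals.
From mathcomp Require Import complex.
From mathcomp Require Import finmap functions ring lra.
From Stdlib Require Import ClassicalEpsilon.
Set Implicit Arguments. Unset Strict Implicit. Unset Printing Implicit Defensive.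
Import Order.TTheory GRing.Theory Num.Theory.
Local Open Scope ring_scope.
Local Open Scope classical_set_scope.

Local Notation "a ** b" := (cs_mul a b) (at level 40, left associativity).
Local Notation "a ^#" := (cs_star a) (at level 2, format "a ^#").
Local Notation nrm := (@cs_norm _ _).

Lemma fsum_morph (U V : nmodType) (f : U -> V) (I : choiceType) (D : set I) (F : I -> U) :
  f 0 = 0 -> {morph f : x y / x + y} -> finite_set D ->
  f (\sum_(i \in D) F i) = \sum_(i \in D) f (F i).
Proof. by move=> f0 fD finD; rewrite !fsbig_finite // (big_morph f fD f0). Qed.

(** * C*-algebras *)

Section CStarTheory.
Variables (R : realType) (A : cstar R).
Implicit Types (a b c e h x y : A) (z : R[i]) (u v : R).

Lemma csmulA a b c : a ** b ** c = a ** (b ** c).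
Proof. by case: (cs_ax A). Qed.

Let mul_linl z a b c : (z *: a + b) ** c = z *: (a ** c) + b ** c.
Proof. by case: (cs_ax A) => _ []. Qed.

Let mul_linr z a b c : a ** (z *: b + c) = z *: (a ** b) + a ** c.
Proof. by case: (cs_ax A) => _ [_ []]. Qed.

Lemma csmulDl a b c : (a + b) ** c = a ** c + b ** c.
Proof. by have := mul_linl 1 a b c; rewrite !scale1r. Qed.

Lemma csmulDr a b c : a ** (b + c) = a ** b + a ** c.
Proof. by have := mul_linr 1 a b c; rewrite !scale1r. Qed.

Lemma csmul0l a : 0 ** a = 0.
Proof. by apply: (addrI (0 ** a)); rewrite -csmulDl !addr0. Qed.

Lemma csmul0r a : a ** 0 = 0.
Proof. by apply: (addrI (a ** 0)); rewrite -csmulDr !addr0. Qed.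

Lemma csmulZl z a b : (z *: a) ** b = z *: (a ** b).
Proof. by have := mul_linl z a 0 b; rewrite csmul0l !addr0. Qed.

Lemma csmulZr z a b : a ** (z *: b) = z *: (a ** b).
Proof. by have := mul_linr z a b 0; rewrite csmul0r !addr0. Qed.

Lemma csmulNl a b : (- a) ** b = - (a ** b).
Proof. by rewrite -scaleN1r csmulZl scaleN1r. Qed.

Lemma csmulNr a b : a ** (- b) = - (a ** b).
Proof. by rewrite -scaleN1r csmulZr scaleN1r. Qed.

Lemma csmulBl a b c : (a - b) ** c = a ** c - b ** c.
Proof. by rewrite csmulDl csmulNl. Qed.

Lemma csmulBr a b c : a ** (b - c) = a ** b - a ** c.
Proof. by rewrite csmulDr csmulNr. Qed.

Lemma csstarK a : a^#^# = a.
Proof. by case: (cs_ax A) => _ [_ [_ []]]. Qed.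

Let star_lin z a b : (z *: a + b)^# = (z^*)%C *: a^# + b^#.
Proof. by case: (cs_ax A) => _ [_ [_ [_ []]]]. Qed.

Lemma csstarM a b : (a ** b)^# = b^# ** a^#.
Proof. by case: (cs_ax A) => _ [_ [_ [_ [_ []]]]]. Qed.

Lemma csstarD a b : (a + b)^# = a^# + b^#.
Proof. by have := star_lin 1 a b; rewrite conjc1 !scale1r. Qed.

Lemma csstar0 : (0 : A)^# = 0.
Proof. by apply: (addrI (0 : A)^#); rewrite -csstarD !addr0. Qed.

Lemma csstarZ z a : (z *: a)^# = (z^*)%C *: a^#.
Proof. by have := star_lin z a 0; rewrite csstar0 !addr0. Qed.

Lemma csstarN a : (- a)^# = - a^#.
Proof. by apply: (addrI a^#); rewrite -csstarD !subrr csstar0. Qed.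

Lemma csstarB a b : (a - b)^# = a^# - b^#.
Proof. by rewrite csstarD csstarN. Qed.

Lemma csnorm_eq0 a : nrm a = 0 -> a = 0.
Proof. by case: (cs_ax A) => _ [_ [_ [_ [_ [_ [H _]]]]]] /H. Qed.

Lemma csnorm0 : nrm (0 : A) = 0.
Proof. by case: (cs_ax A) => _ [_ [_ [_ [_ [_ [H _]]]]]]; apply/H. Qed.

Lemma csnormD a b : nrm (a + b) <= nrm a + nrm b.
Proof. by case: (cs_ax A) => _ [_ [_ [_ [_ [_ [_ []]]]]]]. Qed.

Lemma csnormZ u a : nrm (u%:C%C *: a) = `|u| * nrm a.
Proof.
case: (cs_ax A) => _ [_ [_ [_ [_ [_ [_ [_ [/(_ (u%:C)%C a) H _]]]]]]]].
by move: H; rewrite normc_def /= expr0n addr0 sqrtr_sqr -rmorphM => /complexI.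
Qed.

Lemma csnormM a b : nrm (a ** b) <= nrm a * nrm b.
Proof. by case: (cs_ax A) => _ [_ [_ [_ [_ [_ [_ [_ [_ []]]]]]]]]. Qed.

Lemma csnorm_sq a : nrm (a^# ** a) = nrm a ^+ 2.
Proof. by case: (cs_ax A) => _ [_ [_ [_ [_ [_ [_ [_ [_ [_ []]]]]]]]]]. Qed.

Lemma cscomplete (w : nat -> A) :
  (forall e : R, 0 < e -> exists N, forall m n, (N <= m)%N -> (N <= n)%N ->
    nrm (w m - w n) < e) ->
  exists a, forall e : R, 0 < e -> exists N, forall n, (N <= n)%N -> nrm (w n - a) < e.
Proof.
by case: (cs_ax A) => _ [_ [_ [_ [_ [_ [_ [_ [_ [_ [_ H]]]]]]]]]]; apply: H.
Qed.

Lemma csnormN a : nrm (- a) = nrm a.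
Proof.
have := csnormZ (-1) a.
by rewrite rmorphN1 scaleN1r normrN1 mul1r.
Qed.

Lemma csnorm_ge0 a : 0 <= nrm a.
Proof. by have := csnormD a (- a); rewrite subrr csnorm0 csnormN; lra. Qed.

Lemma csdistC a b : nrm (a - b) = nrm (b - a).
Proof. by rewrite -csnormN opprB. Qed.

Lemma csmul_sq_eq0 a : a^# ** a = 0 -> a = 0.
Proof.
move=> /(congr1 nrm); rewrite csnorm_sq csnorm0 => /eqP.
by rewrite sqrf_eq0 => /eqP /csnorm_eq0.
Qed.

Lemma csmul_fsumr (I : choiceType) (D : set I) (F : I -> A) a : finite_set D ->
  a ** \sum_(i \in D) F i = \sum_(i \in D) (a ** F i).
Proof. exact: (fsum_morph _ (csmul0r a) (csmulDr a)). Qed.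

Lemma csmul_fsuml (I : choiceType) (D : set I) (F : I -> A) a : finite_set D ->
  (\sum_(i \in D) F i) ** a = \sum_(i \in D) (F i ** a).
Proof. exact: (fsum_morph (f := fun x => x ** a) _ (csmul0l a) (fun b c => csmulDl b c a)). Qed.

Lemma csstar_fsum (I : choiceType) (D : set I) (F : I -> A) : finite_set D ->
  (\sum_(i \in D) F i)^# = \sum_(i \in D) (F i)^#.
Proof. exact: (fsum_morph _ csstar0 csstarD). Qed.

End CStarTheory.

(** * Orthogonality of projections *)

Section Projections.
Variables (R : realType) (A : cstar R).
Implicit Types (a b c e h x y : A) (z : R[i]) (u v : R).

Definition projection e := e ** e = e /\ e^# = e.

Lemma projection_norm_le1 e : projection e -> nrm e <= 1.
Proof.
move=> [ee se]; have := csnorm_sq e; rewrite se ee => H.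
by have := csnorm_ge0 e; have [//|] := lerP (nrm e) 1; nra.
Qed.

(** Induction on [n] for all [u] at once. Each step averages the bounds at [u + 1] and [u - 1], and
    half of [(u + 1)^2 + (u - 1)^2] is [u^2 + 1]. With [v] of order [sqrt n], the norm of [n h]
    grows at most like [sqrt n]. *)
Lemma corner_norm_le (e h : A) (n : nat) u v : nrm e <= 1 ->
    e ** e = e -> e ** h = h -> h ** e = h ->
    nrm (e + h) <= 1 -> nrm (e - h) <= 1 -> 0 < v ->
  2 * v * nrm (u%:C%C *: e + n%:R%:C%C *: h) <= u ^+ 2 + n%:R + v ^+ 2.
Proof.
move=> e1 ee eh he hp hm v0; elim: n u => [|n IHn] u.
  rewrite scale0r !addr0 csnormZ.
  have := csnorm_ge0 e; have := normr_ge0 u; have := sqr_ge0 (`|u| - v).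
  by rewrite -(real_normK (num_real u)); nra.
have E : 2%:R%:C%C *: (u%:C%C *: e + n.+1%:R%:C%C *: h) =
    (e + h) ** ((u + 1)%:C%C *: e + n%:R%:C%C *: h) +
    (e - h) ** ((u - 1)%:C%C *: e + n%:R%:C%C *: h).
  rewrite csmulDl csmulBl !csmulDr !csmulZr ee eh he opprD.
  (* Like terms of the two products are paired; the terms in [h ** h] cancel. *)
  rewrite (AC ((2*2)*(2*2)) ((1*5)*(2*6)*(3*7)*(4*8))) /= subrr addr0.
  rewrite -!scalerBl -!scalerDl -[RHS]addrA -scalerDl scalerDr !scalerA.
  rewrite -[in LHS]natr1; congr (_ *: _ + _ *: _); ring.
have := IHn (u + 1); have := IHn (u - 1).
set X := _ *: e + _ in E *; set Y := (u - 1)%:C%C *: e + _ in E *.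
set Z := (u + 1)%:C%C *: e + _ in E *.
have := csnormD ((e + h) ** Z) ((e - h) ** Y); rewrite -E csnormZ normr_nat.
have := csnormM (e + h) Z; have := csnormM (e - h) Y.
have := csnorm_ge0 Y; have := csnorm_ge0 Z; have := csnorm_ge0 X.
rewrite -(natr1 n); set x := nrm X; set y := nrm Y; set z := nrm Z.
move=> x0 z0 y0 ly lz lx iy iz.
have {ly lz lx} : 2 * x <= z + y by nra.
by move=> l; have : v * (2 * x) <= v * (z + y); [rewrite ler_pM2l|lra].
Qed.

Lemma corner_extreme (e h : A) : projection e -> e ** h = h -> h ** e = h ->
  nrm (e + h) <= 1 -> nrm (e - h) <= 1 -> h = 0.
Proof.
move=> pe eh he hp hm; apply: csnorm_eq0; apply/eqP; apply: contraT => h0.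
have {h0} : 0 < nrm h by rewrite lt_neqAle eq_sym h0 csnorm_ge0.
move=> hgt; have := archi_boundP (ltW (_ : 0 < (nrm h)^-1)).
rewrite invr_gt0 => /(_ hgt); set m := Num.bound _ => hm1.
have m0 : 0 < (m%:R : R) by apply: lt_trans hm1; rewrite invr_gt0.
(* With [n = m^2], [u = 0], [v = m] the bound reads [2 m^3 |h| <= 2 m^2], against [m |h| > 1]. *)
have := @corner_norm_le e h (m * m) 0 m%:R (projection_norm_le1 pe) pe.1 eh he hp hm m0.
rewrite scale0r add0r expr0n add0r csnormZ normr_nat natrM => H.
have : 1 < m%:R * nrm h by rewrite -ltr_pdivrMr // mul1r.
set M : R := m%:R in H m0 *; set x := nrm h in H *.
move=> H1; have : M ^+ 2 * (M * x) <= M ^+ 2 by lra.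
by rewrite ger_pMr ?exprn_gt0 // leNgt H1.
Qed.

(* In the corner of the projection e this says that h is positive. *)
Let cpos e h := exists2 u : R, 0 < u & nrm (u%:C%C *: e - h) <= u.

Let cposD e h1 h2 : cpos e h1 -> cpos e h2 -> cpos e (h1 + h2).
Proof.
move=> [u u0 hu] [v v0 hv]; exists (u + v); first exact: addr_gt0.
rewrite rmorphD scalerDl opprD addrACA.
by apply: le_trans (csnormD _ _) _; rewrite lerD.
Qed.

Let cpos0 e : projection e -> cpos e 0.
Proof.
by move=> /projection_norm_le1 e1; exists 1; rewrite // rmorph1 scale1r subr0.
Qed.

(** Both radii can be enlarged to [u + v]; then [h / (u + v)] and its negative meet the hypotheses
    of [corner_extreme]. *)
Let cpos_anti e h : projection e -> e ** h = h -> h ** e = h ->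
  cpos e h -> cpos e (- h) -> h = 0.
Proof.
move=> pe eh he [u u0 hu] [v v0 hv].
have uv0 : 0 < u + v by exact: addr_gt0.
have e1 := projection_norm_le1 pe.
have H1 : nrm ((u + v)%:C%C *: e - h) <= u + v.
  rewrite rmorphD scalerDl addrAC; apply: le_trans (csnormD _ _) _.
  by rewrite lerD // csnormZ gtr0_norm // ger_pMr.
have H2 : nrm ((u + v)%:C%C *: e + h) <= u + v.
  rewrite rmorphD scalerDl -addrA; apply: le_trans (csnormD _ _) _.
  by move: hv; rewrite opprK => hv; rewrite lerD // csnormZ gtr0_norm // ger_pMr.
have E (w : A) : w = (u + v)%:C%C *: ((u + v)^-1%:C%C *: w).
  by rewrite scalerA -rmorphM divff ?gt_eqF // rmorph1 scale1r.
rewrite (E h) (corner_extreme pe (h := (u + v)^-1%:C%C *: h)) ?scaler0 //.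
- by rewrite csmulZr eh.
- by rewrite csmulZl he.
- by rewrite -(ler_pM2l uv0) mulr1; move: H2; rewrite {1}(E h) -scalerDr csnormZ gtr0_norm.
- by rewrite -(ler_pM2l uv0) mulr1; move: H1; rewrite {1}(E h) -scalerBr csnormZ gtr0_norm.
Qed.

(** For [y = e - g e], both [y^# y] and [e y] equal [e - e g e]. Hence [|y|^2 <= |e| |y| <= |y|], so
    [|y| <= 1]. *)
Let cpos_compress e g : projection e -> projection g -> cpos e (e ** g ** e).
Proof.
move=> [ee se] [gg sg]; exists 1 => //; rewrite rmorph1 scale1r.
pose y := e - g ** e.
have Ey : y^# ** y = e - e ** g ** e.
  rewrite /y csstarB csstarM se sg csmulBl !csmulBr ee.
  by rewrite -!csmulA (csmulA e g g) gg subrr subr0.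
have Ey2 : e ** y = e - e ** g ** e by rewrite /y csmulBr ee csmulA.
rewrite -Ey csnorm_sq.
have := csnormM e y; have := csnorm_sq y; rewrite Ey -Ey2.
have := projection_norm_le1 (conj ee se); have := csnorm_ge0 y; have := csnorm_ge0 e.
move=> e0 y0 e1 -> h; have {h} : nrm y ^+ 2 <= nrm y by nra.
have [//|y1] := lerP (nrm y) 1; first by nra.
by nra.
Qed.

Let cpos_fsum (I : choiceType) (D : set I) e (F : I -> A) : projection e ->
  finite_set D -> (forall i, D i -> cpos e (F i)) -> cpos e (\sum_(i \in D) F i).
Proof.
move=> pe fD HF; rewrite fsbig_finite // big_seq.
apply: big_ind => [||i]; [exact: cpos0|exact: cposD|].
by rewrite in_fset_set // => /set_mem /HF.
Qed.

(** In the corner of [g i], the compression of [g j] is positive, and so is its negative, because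
    the compressed total sum has norm at most 1 and already contains [g i]. *)
Lemma fsum_projection_orthogonal (I : choiceType) (D : set I) (g : I -> A) :
  finite_set D -> (forall i, D i -> projection (g i)) ->
  projection (\sum_(i \in D) g i) ->
  forall i j, D i -> D j -> i <> j -> g i ** g j = 0.
Proof.
move=> fD pg pP i j Di Dj nij.
have [ei si] := pg i Di; have [ej sj] := pg j Dj.
have fD' : finite_set (D `\ i) by exact: finite_setD.
have fD'' : finite_set ((D `\ i) `\ j) by exact: finite_setD.
(* This product is [x^# ** x] for [x = g j ** g i]. *)
suff H : g i ** g j ** g i = 0.
  rewrite -[LHS]csstarK csstarM si sj; apply: (canLR (@csstarK _ A)).
  rewrite csstar0; apply: csmul_sq_eq0.
  by rewrite csstarM si sj -csmulA (csmulA (g i)) ej.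
have dec : g i ** (\sum_(l \in D) g l) ** g i = g i +
    (g i ** g j ** g i + \sum_(l \in (D `\ i) `\ j) (g i ** g l ** g i)).
  rewrite csmul_fsumr // csmul_fsuml // (fsbigD1 i) // ei ei.
  by rewrite (fsbigD1 j) //; split=> // /esym.
apply: (@cpos_anti (g i)) => //.
- by rewrite !csmulA -(csmulA (g i) (g i)) ei.
- by rewrite csmulA ei.
- exact: cpos_compress.
have -> : - (g i ** g j ** g i) = (g i - g i ** (\sum_(l \in D) g l) ** g i) +
   \sum_(l \in (D `\ i) `\ j) (g i ** g l ** g i).
  by rewrite dec !opprD addrA subrr add0r -addrA addNr addr0.
apply: cposD.
  exists 1 => //; rewrite rmorph1 scale1r opprB addrC subrK.
  have g1 := projection_norm_le1 (pg i Di); have P1 := projection_norm_le1 pP.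
  apply: le_trans (csnormM _ _) _; apply: mulr_ile1 => //; try exact: csnorm_ge0.
  by apply: le_trans (csnormM _ _) _; apply: mulr_ile1 => //; exact: csnorm_ge0.
by apply: cpos_fsum => // l [[Dl _] _]; apply: cpos_compress => //; apply: pg.
Qed.
End Projections.

(** * Boundedness of *-homomorphisms *)

Section Convergence.
Variables (R : realType) (A : cstar R).
Implicit Types (a b c h x y : A) (w : nat -> A).

Lemma csnorm_star a : nrm a^# = nrm a.
Proof.
suff le b : nrm b <= nrm b^# by apply/eqP; rewrite eq_le -{2}[a]csstarK !le.
have := csnormM b^# b; rewrite csnorm_sq.
by have := csnorm_ge0 b; have := csnorm_ge0 b^#; have [//|] := lerP (nrm b) (nrm b^#); nra.
Qed.

Lemma csnorm_selfadjoint_sq a : a^# = a -> nrm (a ** a) = nrm a ^+ 2.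
Proof. by move=> sa; rewrite -{1}sa csnorm_sq. Qed.

Definition converges w b :=
  forall e : R, 0 < e -> exists N, forall n, (N <= n)%N -> nrm (w n - b) < e.

Lemma converges_unique w a b : converges w a -> converges w b -> a = b.
Proof.
move=> wa wb; apply/eqP; rewrite -subr_eq0; apply/eqP/csnorm_eq0/eqP.
apply: contraT => ab; have {}ab : 0 < nrm (a - b) / 2.
  by rewrite divr_gt0 // lt_neqAle eq_sym ab csnorm_ge0.
have [N HN] := wa _ ab; have [M HM] := wb _ ab.
have := HN _ (leq_maxl N M); have := HM _ (leq_maxr N M).
set n := maxn N M; have := csnormD (a - w n) (w n - b).
by rewrite subrKA (csdistC a); lra.
Qed.

Lemma converges_lip (B : cstar R) w b (F : nat -> B) (c : B) (C : R) :
  converges w b -> (forall n, nrm (F n - c) <= C * nrm (w n - b)) ->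
  forall e : R, 0 < e -> exists N, forall n, (N <= n)%N -> nrm (F n - c) < e.
Proof.
(* Adding 1 keeps the divisor positive even when [C] is zero. *)
move=> wb FC e e0; have C0 : 0 < `|C| + 1 by rewrite ltr_wpDl.
have [N HN] := wb _ (divr_gt0 e0 C0); exists N => n /HN.
rewrite ltr_pdivlMr // => H; apply: le_lt_trans (FC n) _; apply: le_lt_trans H.
by rewrite mulrC ler_wpM2l ?csnorm_ge0 //; have := ler_norm C; lra.
Qed.

Let half_sq g x := 2^-1%:C%C *: (g + x ** x) : A.

Let half_sq_lip g x y : nrm (half_sq g x - half_sq g y) <=
  2^-1 * (nrm x + nrm y) * nrm (x - y).
Proof.
rewrite /half_sq -scalerBr csnormZ ger0_norm ?invr_ge0 // -mulrA ler_pM2l ?invr_gt0 //.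
have -> : g + x ** x - (g + y ** y) = x ** (x - y) + (x - y) ** y.
  by rewrite csmulBr csmulBl addrA subrK opprD addrACA subrr add0r.
apply: le_trans (csnormD _ _) _; rewrite mulrDl (mulrC (nrm y)).
by rewrite lerD // csnormM.
Qed.

(* [1 - b] is a square root of [1 - h^2] in the unitization. *)
Lemma selfadjoint_sqrt h : h^# = h -> nrm h ^+ 2 <= 2^-1 ->
  exists b, [/\ b^# = b, b ** h = h ** b & b + b = h ** h + b ** b].
Proof.
(* The equation for [b] is the fixed-point equation of [half_sq g]. The iterates from 0 stay in the
   ball of radius 1/2, where this map contracts by the factor 1/2; symmetry and commutation with [h]
   pass to the limit. *)
move=> sh nh; set g := h ** h; pose w n := iter n (half_sq g) 0.
have ng : nrm g <= 2^-1 by rewrite csnorm_selfadjoint_sq.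
have w_norm n : nrm (w n) <= 2^-1.
  elim: n => [|n IHn]; first by rewrite csnorm0 invr_ge0.
  rewrite /w iterS -/(w n) csnormZ ger0_norm ?invr_ge0 //.
  have := csnormD g (w n ** w n); have := csnormM (w n) (w n).
  have := csnorm_ge0 (w n).
  by move: (nrm (w n)) (nrm (_ + _)) (nrm (_ ** _)) IHn => p q r; nra.
have w_contract m n : nrm (w (n + m)%N - w n) <= 2^-1 ^+ n.
  elim: n => [|n IHn].
    by rewrite subr0 expr0; apply: le_trans (w_norm _) _; rewrite invf_le1 ?ler1n.
  rewrite addSn /w !iterS -/(w n) -/(w (n + m)%N).
  apply: le_trans (half_sq_lip _ _ _) _; rewrite exprS.
  have := w_norm n; have := w_norm (n + m)%N.
  have := csnorm_ge0 (w n); have := csnorm_ge0 (w (n + m)%N).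
  have := csnorm_ge0 (w (n + m)%N - w n).
  by move=> r0 p0 q0 p1 q1; apply: ler_pM => //; lra.
have w_star n : (w n)^# = w n.
  elim: n => [|n IHn]; first exact: csstar0.
  by rewrite /w iterS -/(w n) /half_sq csstarZ conjc_real csstarD !csstarM sh IHn.
have w_comm n : w n ** h = h ** w n.
  elim: n => [|n IHn]; first by rewrite csmul0l csmul0r.
  rewrite /w iterS -/(w n) /half_sq csmulZl csmulZr csmulDl csmulDr.
  by rewrite !csmulA IHn -(csmulA (w n) h) IHn csmulA.
have [b wb] : exists b, converges w b.
  apply: cscomplete => e e0.
  have [N HN] : exists N, 2^-1 ^+ N < e / 2.
    have e2 : 0 < e / 2 by rewrite divr_gt0.
    have := archi_boundP (ltW (_ : 0 < (e / 2)^-1)); rewrite invr_gt0 => /(_ e2).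
    set N := Num.bound _ => HN; exists N; rewrite exprVn.
    rewrite -[e / 2]invrK ltf_pV2 ?posrE ?invr_gt0 ?exprn_gt0 //.
    apply: lt_le_trans HN _.
    by rewrite -natrX ler_nat ltnW // ltn_expl.
  exists N => m n Nm Nn; have := csnormD (w m - w N) (w N - w n).
  rewrite subrKA (csdistC (w N)).
  have := w_contract (m - N)%N N; have := w_contract (n - N)%N N.
  rewrite !subnKC //; lra.
exists b; split.
- apply: (converges_unique _ wb); apply: (converges_lip (C := 1) wb) => n.
  by rewrite -(w_star n) -csstarB csnorm_star w_star mul1r.
- apply: (@converges_unique (fun n => w n ** h)).
    apply: (converges_lip (C := nrm h) wb) => n.
    by rewrite -csmulBl mulrC csnormM.
  apply: (converges_lip (C := nrm h) wb) => n.
  by rewrite w_comm -csmulBr csnormM.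
have fix_b : b = half_sq g b.
  apply: (@converges_unique (fun n => w n.+1)).
    by move=> e /wb[N HN]; exists N => n Nn; apply: HN; apply: leqW.
  apply: (converges_lip (C := 2^-1 * (2^-1 + nrm b)) wb) => n.
  apply: le_trans (half_sq_lip _ _ _) _.
  by rewrite ler_wpM2r ?csnorm_ge0 // ler_wpM2l ?invr_ge0 // lerD2r.
rewrite -[RHS]scale1r -(rmorph1 (real_complex R)) -[1](@mulVf R 2) ?pnatr_eq0 //.
by rewrite mulrC rmorphM -scalerA -/(half_sq g b) -fix_b rmorph_nat scaler_nat mulr2n.
Qed.

(** The last hypothesis says [(1 - c)^2 = 1 - x^2]. As [A] may lack a unit, the unitary
    [x + i (1 - c)] is used only after multiplication by [x]: the product [y] has norm [|x|], while
    [y + y^# = 2 x^2], so [|x|^2 <= |x|]. *)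
Lemma selfadjoint_norm_le1 x c : x^# = x -> c^# = c -> c ** x = x ** c ->
  c + c = x ** x + c ** c -> nrm x <= 1.
Proof.
move=> sx sc cx cc; pose i : R[i] := (0 +i* 1)%C.
have ii : i * i = -1.
  by apply/eqP; rewrite eq_complex /= !(mul0r, mulr0, mulr1, sub0r, addr0, oppr0) !eqxx.
have ci : (i^*)%C = - i by apply/eqP; rewrite eq_complex /= oppr0 !eqxx.
pose w := x - c ** x; have sw : w^# = w by rewrite /w csstarB csstarM sx sc cx.
(* Formally [w = (1 - c) x], so its square is [(1 - x^2) x^2]. *)
have ww : w ** w = x ** x - x ** x ** (x ** x).
  have xc t : x ** (c ** t) = c ** (x ** t) by rewrite -!csmulA cx.
  have E : c ** (x ** x) + c ** (x ** x) = x ** (x ** (x ** x)) + c ** (c ** (x ** x)).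
    by have := congr1 (fun t => t ** (x ** x)) cc; rewrite /= !csmulDl !csmulA.
  have AC3 (p q r : A) : p - q - (q - r) = p - (q + q) + r.
    by rewrite opprB opprD !addrA [in LHS]addrAC.
  by rewrite /w csmulBl !csmulBr !csmulA !xc AC3 E opprD addrA subrK.
have wxx : w ** (x ** x) = x ** x ** w.
  by rewrite /w csmulBl csmulBr !csmulA -(csmulA x c) -cx !csmulA -(csmulA x c) -cx !csmulA.
(* [y = u x] where [u = x + i (1 - c)] is unitary in the unitization. *)
pose y := x ** x + i *: w.
have sy : y^# = x ** x - i *: w.
  by rewrite csstarD csstarM sx csstarZ sw ci scaleNr.
have yy : y^# ** y = x ** x.
  rewrite sy csmulBl !csmulDr !csmulZl !csmulZr scalerA ii wxx ww scaleN1r.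
  by rewrite opprB addrACA subrr addr0 addrC subrK.
have ny : nrm y = nrm x.
  apply/eqP; rewrite -(eqrXn2 (n := 2)) ?csnorm_ge0 //.
  by rewrite -csnorm_sq yy csnorm_selfadjoint_sq.
have : nrm (y + y^#) <= nrm x + nrm x.
  by apply: le_trans (csnormD _ _) _; rewrite csnorm_star ny.
rewrite sy addrACA subrr addr0 -mulr2n -scaler_nat -(rmorph_nat (real_complex R)).
rewrite csnormZ normr_nat csnorm_selfadjoint_sq //.
by have := csnorm_ge0 x; have [//|] := lerP (nrm x) 1; nra.
Qed.
End Convergence.

(** * Norm bound and continuity of star-homomorphisms *)

Section StarHom.
Variables (R : realType) (A B : cstar R) (f : A -> B).
Hypothesis hf : star_hom f.

Lemma star_homD a b : f (a + b) = f a + f b.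
Proof. by case: hf => H _ _; have := H 1 a b; rewrite !scale1r. Qed.

Lemma star_hom0 : f 0 = 0.
Proof. by apply: (addrI (f 0)); rewrite -star_homD !addr0. Qed.

Lemma star_homZ z a : f (z *: a) = z *: f a.
Proof. by case: hf => H _ _; have := H z a 0; rewrite star_hom0 !addr0. Qed.

Lemma star_homM a b : f (a ** b) = f a ** f b.
Proof. by case: hf. Qed.

Lemma star_hom_star a : f a^# = (f a)^#.
Proof. by case: hf. Qed.

Lemma star_homB a b : f (a - b) = f a - f b.
Proof. by rewrite star_homD -scaleN1r star_homZ scaleN1r. Qed.

Lemma star_hom_fsum (I : choiceType) (D : set I) (F : I -> A) : finite_set D ->
  f (\sum_(i \in D) F i) = \sum_(i \in D) f (F i).
Proof. exact: (fsum_morph _ star_hom0 star_homD). Qed.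

(** Scaling [a] to norm 1/2 makes [h = a^# a] small enough for [selfadjoint_sqrt]. The relations
    between [h] and [b] are algebraic, so [f] carries them to [f h] and [f b]. Any constant would
    serve for continuity. *)
Lemma star_hom_norm_le (a : A) : nrm (f a) <= 2 * nrm a.
Proof.
have [a0|na0] := eqVneq (nrm a) 0.
  by rewrite (csnorm_eq0 a0) star_hom0 !csnorm0 mulr0.
have {na0} na : 0 < nrm a by rewrite lt_neqAle eq_sym na0 csnorm_ge0.
pose u : R := (2 * nrm a)^-1; have u0 : 0 < u by rewrite invr_gt0 mulr_gt0.
pose a' := u%:C%C *: a; pose h := a'^# ** a'.
have sh : h^# = h by rewrite csstarM csstarK.
have na' : nrm a' = 2^-1.
  by rewrite csnormZ gtr0_norm // /u invfM mulfVK // gt_eqF.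
have [|b [sb bh bb]] := selfadjoint_sqrt sh.
  by rewrite csnorm_sq na' -exprM exprVn lef_pV2 ?posrE ?exprn_gt0 // -natrX ler_nat.
have : nrm (f h) <= 1.
  apply: (@selfadjoint_norm_le1 _ _ _ (f b)); rewrite -?star_hom_star ?sh ?sb //.
    by rewrite -!star_homM bh.
  by rewrite -!star_homM -!star_homD bb.
rewrite star_homM star_hom_star csnorm_sq star_homZ csnormZ gtr0_norm //.
rewrite expr_le1 ?mulr_ge0 ?csnorm_ge0 ?(ltW u0) //.
by rewrite /u mulrC ler_pdivrMr ?mulr_gt0 // mul1r.
Qed.

Lemma star_hom_converges (w : nat -> A) b :
  converges w b -> converges (fun n => f (w n)) (f b).
Proof.
move=> wb; apply: (converges_lip (C := 2) wb) => n.
by rewrite -star_homB star_hom_norm_le.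
Qed.
End StarHom.

Lemma star_hom_comp (R : realType) (A B C : cstar R) (f : A -> B) (g : B -> C) :
  star_hom f -> star_hom g -> star_hom (g \o f).
Proof.
move=> hf hg; split=> [z a b|a b|a] /=.
- by rewrite star_homD // star_homZ // star_homD // star_homZ.
- by rewrite star_homM // star_homM.
- by rewrite star_hom_star // star_hom_star.
Qed.

(** By continuity of [f], its fixed points form a closed star-subalgebra. *)
Lemma generates_fixed (R : realType) (A : cstar R) (S : set A) (f : A -> A) :
  generates S -> star_hom f -> (forall a, S a -> f a = a) -> forall a, f a = a.
Proof.
move=> gS hf fS a; have : [set: A] a by []; suff <- : [set a | f a = a] = setT by [].
apply: gS => //=.
- by move=> b c fb fc; rewrite star_homD // fb fc.
- by move=> z b fb; rewrite star_homZ // fb.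
- by move=> b c fb fc; rewrite star_homM // fb fc.
- by move=> b fb; rewrite star_hom_star // fb.
- move=> w b fw wb; apply: (converges_unique _ wb) => e.
  move=> /(star_hom_converges hf wb)[N HN]; exists N => n Nn.
  by rewrite -(fw n); apply: HN.
Qed.

(** * Paths and their segments *)

Section Degrees.
Variable k : nat.
Implicit Types l m n : nvec k.

Lemma vaddA l m n : vadd l (vadd m n) = vadd (vadd l m) n.
Proof. by apply/ffunP => i; rewrite !ffunE addnA. Qed.

Lemma vaddC m n : vadd m n = vadd n m.
Proof. by apply/ffunP => i; rewrite !ffunE addnC. Qed.

Lemma vadd0n n : vadd (vzero k) n = n.
Proof. by apply/ffunP => i; rewrite !ffunE. Qed.

Lemma vaddn0 n : vadd n (vzero k) = n.
Proof. by rewrite vaddC vadd0n. Qed.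

Lemma vaddIn n : injective (vadd n).
Proof.
by move=> l m /ffunP E; apply/ffunP => i; have := E i; rewrite !ffunE => /addnI.
Qed.

Lemma vaddKn m n : vsub (vadd m n) m = n.
Proof. by apply/ffunP => i; rewrite !ffunE addKn. Qed.

Lemma vaddnK m n : vsub (vadd m n) n = m.
Proof. by rewrite vaddC vaddKn. Qed.

Lemma vsubnn n : vsub n n = vzero k.
Proof. by apply/ffunP => i; rewrite !ffunE subnn. Qed.

Lemma vsubnKC m n : vle m n -> vadd m (vsub n m) = n.
Proof. by move=> /forallP mn; apply/ffunP => i; rewrite !ffunE subnKC. Qed.

Lemma vle_refl n : vle n n.
Proof. by apply/forallP. Qed.

Lemma vle_addr m n : vle m (vadd m n).
Proof. by apply/forallP => i; rewrite ffunE leq_addr. Qed.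

Lemma vle_addl m n : vle m (vadd n m).
Proof. by rewrite vaddC vle_addr. Qed.
End Degrees.

(** * Unique factorisation and the path operations of the dual graph *)

Section KGraphTheory.
Variables (k : nat) (L : kgdata k).
Hypothesis HL : is_kgraph L.
Implicit Types a b c v : kpath L.
Local Notation d := (@kdeg _ L).
Local Notation r := (@kr _ L).
Local Notation s := (@ks _ L).
Local Notation "a ;* b" := (@kcomp _ L a b) (at level 40, left associativity).

Lemma kr_vertex a : is_vertex (r a).
Proof. by case: HL => -[/(_ a)[]]. Qed.

Lemma ks_vertex a : is_vertex (s a).
Proof. by case: HL => -[/(_ a)[]]. Qed.

Lemma vertex_r v : is_vertex v -> r v = v.
Proof. by case: HL => -[_ H] _ _ _ _ /H[]. Qed.

Lemma vertex_s v : is_vertex v -> s v = v.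
Proof. by case: HL => -[_ H] _ _ _ _ /H[]. Qed.

Lemma krs a : r (s a) = s a. Proof. exact/vertex_r/ks_vertex. Qed.
Lemma ksr a : s (r a) = r a. Proof. exact/vertex_s/kr_vertex. Qed.

Lemma kr_comp a b : s a = r b -> r (a ;* b) = r a.
Proof. by case: HL => _ H _ _ _ /H[]. Qed.

Lemma ks_comp a b : s a = r b -> s (a ;* b) = s b.
Proof. by case: HL => _ H _ _ _ /H[_ []]. Qed.

Lemma kdeg_comp a b : s a = r b -> d (a ;* b) = vadd (d a) (d b).
Proof. by case: HL => _ H _ _ _ /H[_ []]. Qed.

Lemma kcompA a b c : s a = r b -> s b = r c -> a ;* b ;* c = a ;* (b ;* c).
Proof. by case: HL => _ _ H _ _; apply: H. Qed.

Lemma krcomp a : r a ;* a = a.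
Proof. by case: HL => _ _ _ /(_ a)[]. Qed.

Lemma kcomps a : a ;* s a = a.
Proof. by case: HL => _ _ _ /(_ a)[]. Qed.

Lemma factor a m n : d a = vadd m n ->
  exists b c, [/\ d b = m, d c = n, s b = r c & a = b ;* c].
Proof.
by case: HL => _ _ _ _ H /H [b [c [? ? ? ? _]]]; exists b, c; split.
Qed.

Lemma factor_unique a b a' b' : s a = r b -> s a' = r b' -> d a = d a' ->
  a ;* b = a' ;* b' -> a = a' /\ b = b'.
Proof.
move=> ab ab' da E.
have db : d b = d b' by apply: (@vaddIn _ (d a)); rewrite -kdeg_comp // E kdeg_comp // da.
case: HL => _ _ _ _ /(_ (a ;* b) (d a) (d b)) [|f [g [_ _ _ _ U]]].
  exact: kdeg_comp.
have [-> ->] := U a b erefl erefl ab erefl.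
by have [-> ->] := U a' b' (esym da) (esym db) ab' E.
Qed.

(** Evaluates the epsilon choice in [seg]: [b] is a candidate, and two applications of unique
    factorisation, first splitting off the last factor and then the first, show that it is the only
    one. *)
Lemma seg_comp a b c l m : s a = r b -> s b = r c -> d a = l -> vadd l (d b) = m ->
  seg (a ;* b ;* c) l m = b.
Proof.
move=> ab bc da dbm.
have dabc : d (a ;* b ;* c) = vadd m (d c).
  by rewrite kdeg_comp ?ks_comp // kdeg_comp // da dbm.
rewrite /seg; set P := fun nu => _.
have [|e [f [[de dE] df ee ef E]]] := epsilon_spec (inhabits (a ;* b ;* c)) P.
  exists b, a, c; split=> //; last by rewrite dabc vaddKn.
  by split=> //; rewrite -dbm vaddKn.
move: (epsilon _ _) dE ee ef E => g dE ee ef E.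
have dg : d g = d b by rewrite dE -dbm vaddKn.
have [] := factor_unique _ _ _ E; rewrite ?ks_comp ?kdeg_comp ?de ?dg ?da //.
by move=> /(factor_unique ab ee)[]; rewrite ?de ?da.
Qed.

Variable p : nvec k.
Implicit Types x y : dpath L p.

Definition dlift a (H : vle p (d a)) : dpath L p := exist _ a H.

Lemma head_factor a : vle p (d a) ->
  exists b c, [/\ d b = p, s b = r c & a = b ;* c].
Proof.
by move=> /vsubnKC/esym/factor[b [c [? _ ? ?]]]; exists b, c.
Qed.

Lemma tail_factor a : vle p (d a) ->
  exists b c, [/\ d c = p, s b = r c & a = b ;* c].
Proof.
by move=> /vsubnKC/esym; rewrite vaddC => /factor[b [c [_ ? ? ?]]]; exists b, c.
Qed.

Lemma seg_tail a c : s a = r c -> d c = p ->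
  seg (a ;* c) (vsub (d (a ;* c)) p) (d (a ;* c)) = c.
Proof.
move=> ac dc; have dac := kdeg_comp ac; rewrite -{1}(kcomps (a ;* c)) ks_comp //.
by apply: seg_comp; rewrite ?krs // dac dc vaddnK.
Qed.

(** The segment has degree [p], so [insubd] does not return its default; likewise for [dval_ds]
    below. *)
Lemma dval_dr x b c : s b = r c -> d b = p -> dval x = b ;* c -> dval (dr x) = b.
Proof.
move=> bc db E; have drE : dr_path x = b.
  rewrite /dr_path E -{1}(krcomp b); apply: seg_comp; rewrite ?ksr ?vadd0n //.
  exact: kr_vertex.
by rewrite /dval /dr insubdK drE // unfold_in db vle_refl.
Qed.

Lemma dval_ds x a c : s a = r c -> d c = p -> dval x = a ;* c -> dval (ds x) = c.
Proof.
move=> ac dc E; have dsE : ds_path x = c by rewrite /ds_path E seg_tail.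
by rewrite /dval /ds insubdK dsE // unfold_in dc vle_refl.
Qed.

Lemma dval_dcomp x y b c : s b = r c -> d b = p -> dval y = b ;* c ->
  s (dval x) = s b -> dval (dcomp x y) = dval x ;* c.
Proof.
move=> bc db E xb; have cE : dcomp_path x y = dval x ;* c.
  rewrite /dcomp_path E; congr kcomp; rewrite -{1}(kcomps (b ;* c)) ks_comp //.
  by apply: seg_comp; rewrite ?krs // kdeg_comp // db.
rewrite /dval /dcomp insubdK cE // unfold_in kdeg_comp ?xb //.
by rewrite -(vsubnKC (valP x)) -vaddA vle_addr.
Qed.

Lemma ddeg_dual_vertex x : @is_vertex _ (dual L p) x <-> d (dval x) = p.
Proof.
rewrite /is_vertex /= /ddeg; split=> [E|->]; last exact: vsubnn.
by rewrite -(vsubnKC (valP x)) E vaddn0.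
Qed.

End KGraphTheory.

Lemma fsum_single (V : nmodType) (I : choiceType) (D : set I) (F : I -> V) i :
  D i -> (forall j, D j -> j <> i -> F j = 0) -> \sum_(j \in D) F j = F i.
Proof.
move=> Di F0; rewrite -[RHS](fsbig_set1 +%R i F); apply/esym/fsbig_widen.
  by move=> j ->.
by move=> j [Dj ji] /=; apply: F0.
Qed.

(** * Cuntz-Krieger families of the dual graph *)

Section DualFamily.
Variables (R : realType) (k : nat) (L : kgdata k).
Hypotheses (HL : is_kgraph L) (Hrf : row_finite L).
Local Notation d := (@kdeg _ L).
Local Notation r := (@kr _ L).
Local Notation s := (@ks _ L).
Local Notation "a ;* b" := (@kcomp _ L a b) (at level 40, left associativity).
Local Notation "v \La n" := (@rdeg_set _ L v n) (at level 30).
Implicit Types a b c v : kpath L.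

(* The Cuntz-Krieger relations of p Lambda, spelled out on Lambda-paths: a path of
   degree at least p with initial segment v is v b, with final segment v is a v. *)
Definition dual_family (p : nvec k) (A : cstar R) (T : kpath L -> A) : Prop :=
  [/\ forall v, d v = p -> projection (T v),
      forall v w, d v = p -> d w = p -> v <> w -> T v ** T w = 0,
      forall a v b, d v = p -> s a = r v -> s v = r b ->
        T (a ;* v) ** T (v ;* b) = T (a ;* v ;* b),
      forall a v, d v = p -> s a = r v -> (T (a ;* v))^# ** T (a ;* v) = T v &
      forall v n, d v = p ->
        T v = \sum_(b \in s v \La n) (T (v ;* b) ** (T (v ;* b))^#)].

Lemma kcomp_set_inj v n : set_inj (s v \La n) (kcomp v).
Proof.
move=> a b /set_mem[ra _] /set_mem[rb _] E.
by have [] := factor_unique HL (esym ra) (esym rb) erefl E.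
Qed.

(** The paths of dual degree [n] and dual range [x] are the extensions of [x] by [n]; both sums are
    reindexed over this common image. *)
Lemma dual_rdeg_sum (V : nmodType) (F : kpath L -> V) p (x : dpath L p) n :
    d (dval x) = p ->
  \sum_(y \in @rdeg_set _ (dual L p) x n) F (dval y) =
  \sum_(b \in s (dval x) \La n) F (dval x ;* b).
Proof.
move=> dx; rewrite -(fsbig_image _ (@dval _ L p) F); last first.
  by move=> y z _ _ /val_inj.
rewrite -(fsbig_image _ (kcomp (dval x)) F); last exact: kcomp_set_inj.
apply: eq_fsbigl; apply/seteqP; split=> e [].
  move=> y [/= yx dy] <- {e}; have [b [c [db bc E]]] := head_factor HL (valP y).
  move: (E) => /(dval_dr HL bc db) => bx; rewrite yx in bx; rewrite [dval y]E bx.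
  exists c => //; split=> //; rewrite -dy /= /ddeg [dval y]E kdeg_comp // db.
  by rewrite vaddKn.
move=> c [rc dc] <- {e}; have dE : d (dval x ;* c) = vadd p n.
  by rewrite kdeg_comp // dx dc.
have H : vle p (d (dval x ;* c)) by rewrite dE vle_addr.
exists (dlift H) => //; split; last by rewrite /= /ddeg dE vaddKn.
by apply: val_inj; apply: (dval_dr HL (esym rc) dx).
Qed.

(** Trades the subtype and its segments for explicit factorisations; [T] may be any extension of [t]
    to all paths. *)
Lemma dual_CK p (A : cstar R) (t : dpath L p -> A) (T : kpath L -> A) :
  (forall x, T (dval x) = t x) ->
  @CK_family _ _ (dual L p) A t <-> dual_family p T.
Proof.
move=> Tt; have lift a : vle p (d a) -> exists x : dpath L p, dval x = a.
  by move=> H; exists (dlift H).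
have lift_vertex v : d v = p -> exists2 x : dpath L p, dval x = v & @is_vertex _ (dual L p) x.
  move=> dv; have [|x xv] := lift v; first by rewrite dv vle_refl.
  by exists x => //; apply/ddeg_dual_vertex; rewrite xv.
split=> [[H1 H2 H3 H4 H5]|[H1 H2 H3 H4 H5]]; split.
- by move=> v /lift_vertex[x <- /H1]; rewrite Tt.
- move=> v w /lift_vertex[x <- xV] /lift_vertex[y <- yV] xy; rewrite !Tt.
  by apply: H2 => // E; rewrite E in xy.
- move=> a v b dv av vb.
  have [|x xE] := lift (a ;* v); first by rewrite kdeg_comp // dv vle_addl.
  have [|y yE] := lift (v ;* b); first by rewrite kdeg_comp // dv vle_addr.
  rewrite -xE -yE !Tt H3.
    rewrite -Tt (dval_dcomp HL vb dv yE) ?xE //.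
    by rewrite ks_comp.
  apply: val_inj; rewrite [LHS](dval_ds HL av dv xE).
  by rewrite [RHS](dval_dr HL vb dv yE).
- move=> a v dv av.
  have [|x xE] := lift (a ;* v); first by rewrite kdeg_comp // dv vle_addl.
  by rewrite -xE Tt H4 -Tt (dval_ds HL av dv xE).
- move=> v n dv; have [x xv xV] := lift_vertex v dv.
  rewrite -xv Tt (H5 x n xV) -(dual_rdeg_sum (fun a => T a ** (T a)^#)) ?xv //.
  by apply: eq_fsbigr => y _; rewrite Tt.
- by move=> x /ddeg_dual_vertex dx; rewrite -Tt; apply: H1.
- move=> x y /ddeg_dual_vertex dx /ddeg_dual_vertex dy xy; rewrite -!Tt.
  by apply: H2 => // E; apply: xy; apply: val_inj.
- move=> x y xy; have [a [v [dv av xE]]] := tail_factor HL (valP x).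
  have [w [b [dw wb yE]]] := head_factor HL (valP y).
  have vw : v = w.
    by rewrite -(dval_ds HL av dv xE) -(dval_dr HL wb dw yE); congr dval.
  rewrite -!Tt (dval_dcomp HL wb dw yE); last by rewrite [dval x]xE ks_comp // vw.
  by rewrite [dval x]xE [dval y]yE -vw H3 // vw.
- move=> x; have [a [v [dv av xE]]] := tail_factor HL (valP x).
  by rewrite -!Tt [dval x]xE H4 // (dval_ds HL av dv xE).
- move=> x n /ddeg_dual_vertex dx; rewrite -Tt (H5 _ n dx).
  rewrite -(dual_rdeg_sum (fun a => T a ** (T a)^#)) //.
  by apply: eq_fsbigr => y _; rewrite Tt.
Qed.

(** The case [p = 0], through which the results on dual families also serve families of [L]
    itself. *)
Lemma CK_dual0 (A : cstar R) (t : kpath L -> A) :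
  CK_family t -> dual_family (vzero k) t.
Proof.
move=> [H1 H2 H3 H4 H5]; split=> //.
- move=> a v b v0 av vb; have va : v = s a by rewrite av vertex_r.
  have {}vb : v = r b by rewrite -vb vertex_s.
  by rewrite {1 3}va kcomps // {1}vb krcomp // H3 // -va.
- move=> a v v0 av; have va : v = s a by rewrite av vertex_r.
  by rewrite va kcomps.
- move=> v n v0; rewrite (H5 _ n v0) (vertex_s HL v0).
  by apply: eq_fsbigr => b /set_mem[<- _]; rewrite krcomp.
Qed.

Lemma rdeg_finite a n : finite_set (s a \La n).
Proof. exact/Hrf/ks_vertex. Qed.

Section FamilyTheory.
Variables (p : nvec k) (A : cstar R) (T : kpath L -> A).
Hypothesis HT : dual_family p T.

Lemma dual_head v b : d v = p -> s v = r b -> T v ** T (v ;* b) = T (v ;* b).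
Proof.
case: HT => _ _ H3 _ _ dv vb; have := H3 (r v) v b dv (ksr HL v) vb.
by rewrite !krcomp.
Qed.

Lemma dual_tail a v : d v = p -> s a = r v -> T (a ;* v) ** T v = T (a ;* v).
Proof.
case: HT => _ _ H3 _ _ dv av; have := H3 a v (s v) dv av (esym (krs HL v)).
by rewrite kcomps // -(ks_comp HL av) kcomps.
Qed.

Lemma dual_range_projection a : vle p (d a) -> projection (T a ** (T a)^#).
Proof.
case: HT => _ _ _ H4 _ /(tail_factor HL)[b [v [dv bv ->]]].
by split; rewrite ?csstarM ?csstarK // csmulA -(csmulA (_^#)) H4 // -csmulA dual_tail.
Qed.

(** Distinct heads of degree [p] are separated by their vertex projections. With a common head [v],
    the range projections of the extensions of [v] sum to the projection [T v], hence are mutually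
    orthogonal. *)
Lemma dual_orthogonal a b : d a = d b -> vle p (d a) -> a <> b -> (T a)^# ** T b = 0.
Proof.
move=> dab pa nab; have pb := pa; rewrite dab in pb.
have [P1 P2 _ _ P5] := HT.
have PI c : vle p (d c) -> T c ** ((T c)^# ** T c) = T c.
  move=> /(tail_factor HL)[e [v [dv ev ->]]].
  by case: HT => _ _ _ -> // _; rewrite dual_tail.
have [v [a' [dv va aE]]] := head_factor HL pa.
have [w [b' [dw wb bE]]] := head_factor HL pb.
have [vw|nvw] := pselect (v = w); last first.
  rewrite aE bE -(dual_head dv va) -(dual_head dw wb) csstarM (P1 _ dv).2.
  by rewrite csmulA -(csmulA (T v)) P2 // csmul0l csmul0r.
rewrite -{}vw in dw wb bE.
suff key : T a ** (T a)^# ** (T b ** (T b)^#) = 0.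
  transitivity ((T a)^# ** (T a ** (T a)^# ** (T b ** (T b)^#)) ** T b).
    by rewrite -{1}(PI _ pb) -{1}(PI _ pa) !csstarM csstarK !csmulA.
  by rewrite key csmul0r csmul0l.
have da' : d a' = d b'.
  by apply: (@vaddIn _ (d v)); rewrite -!kdeg_comp // -aE -bE.
rewrite aE bE.
apply: (@fsum_projection_orthogonal _ _ _ (s v \La d a')
  (fun c => T (v ;* c) ** (T (v ;* c))^#)).
- exact: rdeg_finite.
- move=> c [rc _]; apply: dual_range_projection.
  by rewrite kdeg_comp // dv vle_addr.
- by rewrite -P5 //; apply: P1.
- by [].
- by [].
- by move=> E; apply: nab; rewrite aE bE E.
Qed.

Lemma dual_orthogonal_tail a b v w : d v = p -> d w = p -> s a = r v -> s b = r w ->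
  v <> w -> T (a ;* v) ** (T (b ;* w))^# = 0.
Proof.
move=> dv dw av bw vw; rewrite -(dual_tail dv av) -(dual_tail dw bw) csstarM.
case: HT => P1 P2 _ _ _.
by rewrite (P1 _ dw).2 csmulA -(csmulA (T v)) P2 // csmul0l csmul0r.
Qed.
End FamilyTheory.

End DualFamily.

(** * The two families *)

Section ShiftedFamily.
Variables (R : realType) (k : nat) (L : kgdata k).
Hypotheses (HL : is_kgraph L) (Hrf : row_finite L).
Local Notation d := (@kdeg _ L).
Local Notation r := (@kr _ L).
Local Notation s := (@ks _ L).
Local Notation "a ;* b" := (@kcomp _ L a b) (at level 40, left associativity).
Local Notation "v \La n" := (@rdeg_set _ L v n) (at level 30).
Implicit Types a b c v : kpath L.
Variables (p : nvec k) (A : cstar R).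

Lemma rdeg_sum_comp (V : nmodType) (F : kpath L -> V) v m n : is_vertex v ->
  \sum_(a \in v \La m) \sum_(b \in s a \La n) F (a ;* b) =
  \sum_(c \in v \La vadd m n) F c.
Proof.
move=> vV; pose ext a := [set a ;* b | b in s a \La n].
(* Extending the inner sum by zero makes its index set independent of [a], so the sums can be
   exchanged; each [c] then has exactly one prefix [a] of degree [m]. *)
transitivity (\sum_(a \in v \La m) \sum_(c \in v \La vadd m n)
    if c \in ext a then F c else 0).
  apply: eq_fsbigr => a /set_mem[ra da]; rewrite -fsbig_mkcondr.
  rewrite -(fsbig_image _ (kcomp a) F); last exact: kcomp_set_inj.
  apply: eq_fsbigl; apply/seteqP; split=> [_ [b [rb db] <-]|c [_ //]].
  split; last by exists b.
  by split; rewrite ?kr_comp ?kdeg_comp // da db.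
rewrite exchange_fsbig; try exact: Hrf.
apply: eq_fsbigr => c /set_mem[rc dc].
have [a [b [da db ab E]]] := factor HL dc.
rewrite (@fsum_single _ _ _ _ a).
- by rewrite ifT //; apply/mem_set; exists b.
- by split=> //; rewrite -rc E kr_comp.
move=> a' [_ da'] a'a; rewrite ifF //; apply/negP => /set_mem[b' [rb' _] E'].
have [|aa _] := factor_unique HL (esym rb') ab _ (etrans E' E); first by rewrite da' da.
by apply: a'a.
Qed.

(* The segment is the final one of degree p, i.e. s_p(a). *)
Definition tail_family (S : kpath L -> A) a :=
  S a ** (S (seg a (vsub (d a) p) (d a)))^#.

Lemma tail_familyE S a v : d v = p -> s a = r v ->
  tail_family S (a ;* v) = S (a ;* v) ** (S v)^#.
Proof. by move=> dv av; rewrite /tail_family seg_tail. Qed.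

Lemma tail_family_dual S : CK_family S -> dual_family p (tail_family S).
Proof.
move=> CS; have D0 := CK_dual0 HL CS; have [S1 S2 S3 S4 S5] := CS.
have Ss a : S a ** S (s a) = S a by rewrite S3 ?kcomps // krs.
have Sr a : S (s a) ** (S a)^# = (S a)^#.
  by rewrite -{2}(Ss a) csstarM (S1 _ (ks_vertex HL a)).2.
have rE v : d v = p -> tail_family S v = S v ** (S v)^#.
  by move=> dv; rewrite -{1}(krcomp HL v) tail_familyE ?krcomp // ksr.
have rr a : vle p (d a) -> tail_family S a ** (tail_family S a)^# = S a ** (S a)^#.
  move=> /(tail_factor HL)[b [v [dv bv ->]]]; rewrite tail_familyE // csstarM csstarK.
  by rewrite csmulA -(csmulA (S v)^#) S4 -(ks_comp HL bv) Sr.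
have v0 a : vle (vzero k) (d a) by rewrite -[d a]vadd0n vle_addr.
split.
- move=> v dv; rewrite (rE v dv).
  by apply: (dual_range_projection HL D0); rewrite v0.
- move=> v w dv dw vw; rewrite !rE // csmulA -(csmulA (S v)^#).
  by rewrite (dual_orthogonal HL Hrf D0) ?dv ?dw ?csmul0l ?csmul0r // -dv v0.
- move=> a v b dv av vb; rewrite tail_familyE //.
  have : vle p (d (v ;* b)) by rewrite kdeg_comp // dv vle_addr.
  (* The final segment [w] of [v ;* b] is also that of [a ;* v ;* b], so both sides end in
     [(S w)^#]. *)
  move=> /(tail_factor HL)[c [w [dw cw E]]].
  rewrite (kcompA HL av vb) E -(kcompA HL _ cw); last first.
    by rewrite av -(kr_comp HL vb) E kr_comp.
  rewrite !tail_familyE //; last first.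
    by rewrite ks_comp // av -(kr_comp HL vb) E kr_comp.
  rewrite (kcompA HL _ cw) -?E; last by rewrite av -(kr_comp HL vb) E kr_comp.
  have vSb : (S v)^# ** S (v ;* b) = S b.
    by rewrite -S3 // -csmulA S4 vb S3 ?ksr // krcomp.
  rewrite -(kcompA HL av vb) csmulA -[_ ** (_ ** _^#)]csmulA vSb -csmulA S3 //.
  by rewrite ks_comp.
- move=> a v dv av; rewrite (rE v dv) tail_familyE // csstarM csstarK csmulA.
  by rewrite -(csmulA (S (a ;* v))^#) S4 ks_comp // Sr.
- move=> v n dv; rewrite rE //.
  (* The inserted projection [S (s v)] is expanded over the paths of degree [n]. *)
  transitivity (S v ** S (s v) ** (S v)^#); first by rewrite Ss.
  rewrite (S5 _ n (ks_vertex HL v)) csmul_fsumr ?csmul_fsuml; try exact: rdeg_finite.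
  apply: eq_fsbigr => b /set_mem[rb db]; rewrite rr; last first.
    by rewrite kdeg_comp // dv vle_addr.
  by rewrite -S3 // csstarM !csmulA.
Qed.

(** * Recovering a family of the original graph by summing over extensions *)

Section HeadSum.
Variable T : kpath L -> A.
Hypothesis HT : dual_family p T.

(** A path need not have degree at least [p], but its extensions by paths of degree [p] do. *)
Definition head_sum a := \sum_(v \in s a \La p) T (a ;* v).

Lemma head_sum_mul a v b : d v = p -> s a = r v -> s v = r b ->
  head_sum a ** T (v ;* b) = T (a ;* v ;* b).
Proof.
move=> dv av vb; rewrite /head_sum csmul_fsuml; last exact: rdeg_finite.
have [P1 P2 P3 _ _] := HT; rewrite (@fsum_single _ _ _ _ v) //; first exact: P3.
move=> w [rw dw] wv; rewrite -(dual_tail HL HT dw (esym rw)) -(dual_head HL HT dv vb).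
by rewrite csmulA -(csmulA (T w)) P2 // csmul0l csmul0r.
Qed.

Lemma head_sum_comp a b : s a = r b -> head_sum a ** head_sum b = head_sum (a ;* b).
Proof.
move=> ab; rewrite {2 3}/head_sum csmul_fsumr; last exact: rdeg_finite.
rewrite ks_comp //; apply: eq_fsbigr => v /set_mem[rv dv].
have : vle p (d (b ;* v)) by rewrite kdeg_comp // dv vle_addl.
move=> /(head_factor HL)[w [c [dw wc E]]].
have aw : s a = r w by rewrite ab -(kr_comp HL (esym rv)) E kr_comp.
by rewrite E head_sum_mul // (kcompA HL aw wc) -E -kcompA.
Qed.

Lemma head_sum_vertex v : is_vertex v -> head_sum v = \sum_(w \in v \La p) T w.
Proof.
move=> vV; rewrite /head_sum vertex_s //; apply: eq_fsbigr => w /set_mem[rw _].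
by rewrite -rw krcomp.
Qed.

Lemma head_sum_range a :
  head_sum a ** (head_sum a)^# =
  \sum_(v \in s a \La p) (T (a ;* v) ** (T (a ;* v))^#).
Proof.
rewrite {1}/head_sum csmul_fsuml; last exact: rdeg_finite.
apply: eq_fsbigr => v /set_mem Hv; have [rv dv] := Hv.
rewrite /head_sum csstar_fsum ?csmul_fsumr; try exact: rdeg_finite.
rewrite (@fsum_single _ _ _ _ v) // => w [rw dw] wv.
by apply: (dual_orthogonal_tail HL HT) => // vw; apply: wv.
Qed.

Lemma head_sum_CK : CK_family head_sum.
Proof.
have [P1 P2 P3 P4 P5] := HT; split.
- move=> v vV; split.
    have vv : v ;* v = v by rewrite -{2}(vertex_s HL vV) kcomps.
    by rewrite head_sum_comp ?vv // vertex_s ?vertex_r.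
  rewrite head_sum_vertex // csstar_fsum; last first.
    by rewrite -(vertex_s HL vV); apply: rdeg_finite.
  by apply: eq_fsbigr => w /set_mem[_ dw]; rewrite (P1 _ dw).2.
- move=> v w vV wV vw; rewrite !head_sum_vertex // csmul_fsuml; last first.
    by rewrite -(vertex_s HL vV); apply: rdeg_finite.
  apply: fsbig1 => a [ra da]; rewrite csmul_fsumr; last first.
    by rewrite -(vertex_s HL wV); apply: rdeg_finite.
  by apply: fsbig1 => b [rb db]; apply: P2 => // ab; apply: vw; rewrite -ra -rb ab.
- by move=> a b; apply: head_sum_comp.
- move=> a; rewrite [RHS]head_sum_vertex; last exact: ks_vertex.
  rewrite {1}/head_sum csstar_fsum ?csmul_fsuml; try exact: rdeg_finite.
  apply: eq_fsbigr => v /set_mem Hv; have [rv dv] := Hv.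
  rewrite /head_sum csmul_fsumr; last exact: rdeg_finite.
  rewrite (@fsum_single _ _ _ _ v) //; first exact: P4.
  move=> w [rw dw] wv; apply: (dual_orthogonal HL Hrf HT).
  + by rewrite !kdeg_comp // dv dw.
  + by rewrite kdeg_comp // dv vle_addl.
  + move=> E; apply: wv.
    by have [] := factor_unique HL (esym rv) (esym rw) erefl E.
- move=> v n vV; under eq_fsbigr do rewrite head_sum_range.
  (* Range projections are summed over all paths of degree [n + p] from [v], then regrouped by their
     heads of degree [p] rather than [n]. *)
  rewrite (rdeg_sum_comp (fun a => T a ** (T a)^#)) // vaddC -rdeg_sum_comp //.
  by rewrite head_sum_vertex //; apply: eq_fsbigr => w /set_mem[_ dw]; apply: P5.
Qed.

(** Shows that [tail_family] undoes [head_sum]: [T (a ;* v)] factors out on the left, and the range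
    projection of [head_sum v] is [T v]. *)
Lemma head_sum_tail a v : d v = p -> s a = r v ->
  head_sum (a ;* v) ** (head_sum v)^# = T (a ;* v).
Proof.
have [_ _ P3 _ P5] := HT.
move=> dv av; have -> : head_sum (a ;* v) = T (a ;* v) ** head_sum v.
  rewrite /head_sum csmul_fsumr ?ks_comp //; last exact: rdeg_finite.
  by apply: eq_fsbigr => w /set_mem[rw dw]; rewrite P3.
by rewrite csmulA head_sum_range -P5 // (dual_tail HL HT).
Qed.
End HeadSum.
End ShiftedFamily.

(** * The isomorphism between the two universal algebras *)

Theorem theorem3p5 (R : realType) (k : nat) (L : kgdata k)
  (HL : is_kgraph L) (Hrf : row_finite L) (Hns : no_sources L)
  (p : nvec k)
  (A : cstar R) (s : kpath L -> A) (Hs : universal_CK s)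
  (B : cstar R) (t : kpath (dual L p) -> B) (Ht : universal_CK t) :
  exists phi : B -> A, star_iso phi /\
    forall lam : kpath (dual L p),
      phi (t lam) = cs_mul (s (dval lam)) (cs_star (s (ds_path lam))).
Proof.
have [CKs gens univs] := Hs; have [CKt gent univt] := Ht.
(* Extension of [t] by 0 to the paths whose degree is not at least [p]. *)
pose T a := if insub a is Some x then t x else 0.
have Tt (x : dpath L p) : T (dval x) = t x by rewrite /T valK.
have DT : dual_family p T by apply/(dual_CK HL Tt).
have [|phi [hphi phiE]] := univt A (fun x => tail_family p s (dval x)).
  by apply/(dual_CK HL (T := tail_family p s)) => //; apply: tail_family_dual.
have [psi [hpsi psiE]] := univs B (head_sum p T) (head_sum_CK HL Hrf DT).
exists phi; split=> //; split=> //; exists psi.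
- apply: (generates_fixed gent (star_hom_comp hphi hpsi)) => _ [x _ <-] /=.
  have [a [v [dv av xE]]] := tail_factor HL (valP x).
  rewrite phiE [dval x]xE tail_familyE // star_homM // star_hom_star // !psiE.
  by rewrite head_sum_tail // -[RHS]Tt [dval x]xE.
- apply: (generates_fixed gens (star_hom_comp hpsi hphi)) => _ [a _ <-] /=.
  rewrite psiE /head_sum star_hom_fsum //; last exact: rdeg_finite.
  have [S1 S2 S3 S4 S5] := CKs.
  (* The source projection of [s a] is expanded in degree [p], to match [phi] of the head sum term
     by term. *)
  have -> : s a = \sum_(v \in rdeg_set (ks a) p) (s a ** (s v ** (s v)^#)).
    rewrite -csmul_fsumr; last exact: rdeg_finite.
    by rewrite -S5 ?S3 ?kcomps ?krs //; apply: ks_vertex.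
  apply: eq_fsbigr => v /set_mem[rv dv].
  have H : vle p (kdeg (kcomp a v)) by rewrite kdeg_comp // dv vle_addl.
  by rewrite -[kcomp a v]/(dval (dlift H)) Tt phiE tail_familyE // -S3 // csmulA.
Qed.
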